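(* The class $\mathcal{LO}_p$ of linearly ordered sets equipped with one order preserving unary operation has the strong amalgamation property.
   Context: A unary operation $f$ on an ordered set is order preserving if $a\le b$ implies $f(a)\le f(b)$. Embeddings are injective maps commuting with the operation and satisfying $c\le d\iff \iota(c)\le\iota(d)$. A class $\mathcal K$ closed under isomorphism has the strong amalgamation property (SAP) if whenever $\mathbf A,\mathbf B,\mathbf C\in\mathcal K$ and $\iota_1:\mathbf C\to\mathbf A$, $\iota_2:\mathbf C\to\mathbf B$ are embeddings, there exist $\mathbf D\in\mathcal K$ and embeddings $j_1:\mathbf A\to\mathbf D$, $j_2:\mathbf B\to\mathbf D$ with $j_1\circ\iota_1=j_2\circ\iota_2$ and $j_1(A)\cap j_2(B)=j_1(\iota_1(C))$. *)

(* Defs.v *)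
From Stdlib Require Import Relation_Definitions FinFun.

(* Raw structures for the signature of one binary relation and one unary
   operation; the axioms are imposed by the class (a predicate on structures).
   The carrier may be empty. *)
Record structure : Type := Structure {
  carrier :> Type;
  le : relation carrier;
  op : carrier -> carrier
}.

Arguments le {s} _ _.
Arguments op {s} _.

Definition embedding {A B : structure} (i : A -> B) : Prop :=
  Injective i /\
  (forall c : A, i (op c) = op (i c)) /\
  (forall c d : A, le c d <-> le (i c) (i d)).

Definition isomorphism {A B : structure} (i : A -> B) : Prop :=
  embedding i /\ Surjective i.

Definition closed_under_isomorphism (K : structure -> Prop) : Prop :=
  forall (A B : structure) (i : A -> B), isomorphism i -> K A -> K B.

Definition strong_amalgamation_property (K : structure -> Prop) : Prop :=
  forall (A B C : structure) (i1 : C -> A) (i2 : C -> B),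
    K A -> K B -> K C -> embedding i1 -> embedding i2 ->
    exists (D : structure) (j1 : A -> D) (j2 : B -> D),
      K D /\ embedding j1 /\ embedding j2 /\
      (forall c : C, j1 (i1 c) = j2 (i2 c)) /\
      (forall d : D,
         (exists a : A, j1 a = d) /\ (exists b : B, j2 b = d) <->
         (exists c : C, j1 (i1 c) = d)).

Definition linear_order (T : Type) (R : relation T) : Prop :=
  order T R /\ (forall x y : T, R x y \/ R y x).

Definition order_preserving (A : structure) : Prop :=
  forall a b : A, le a b -> le (op a) (op b).

Definition LO_p (A : structure) : Prop :=
  linear_order A le /\ order_preserving A.

Lemma LO_p_closed_under_isomorphism : closed_under_isomorphism LO_p.
Proof.
  intros A B i [[_ [Hop Hle]] Hs] [[[Hr Ht Ha] Htot] Hm].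
  split; [split; [split|]|].
  - intros x; destruct (Hs x) as [a <-]; apply Hle, Hr.
  - intros x y z; destruct (Hs x) as [a <-], (Hs y) as [b <-], (Hs z) as [c <-].
    rewrite <- !Hle; apply Ht.
  - intros x y; destruct (Hs x) as [a <-], (Hs y) as [b <-].
    rewrite <- !Hle; intros H1 H2; f_equal; apply Ha; assumption.
  - intros x y; destruct (Hs x) as [a <-], (Hs y) as [b <-].
    rewrite <- !Hle; apply Htot.
  - intros x y; destruct (Hs x) as [a <-], (Hs y) as [b <-].
    rewrite <- !Hop, <- !Hle; apply Hm.
Qed.

(* Main.v *)
Require Import Defs.
From Stdlib Require Import Relation_Definitions FinFun.
From Stdlib Require Import ClassicalEpsilon FunctionalExtensionality PropExtensionality.

(** The amalgam lives on [A + B] modulo the identification of the two copies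
    of [C].  For [b] in [B] and [a] in [A], put [b] strictly below [a] exactly
    when, for some [n], the common part [C] forces [f^n b < f^n a], that is,
    [f^n b <= c <= f^n a] for some [c] in [C], not both equalities; in all
    other cases put [a <= b].  Looking along the whole orbit is what makes [f]
    order preserving, and resolving every undecided pair in favour of [A] is
    what makes the relation transitive. *)

(** * From a total preorder with a monotone operation to a linear order *)

Section AntisymmetricQuotient.

Variables (T : Type) (le0 : relation T) (op0 : T -> T).
Hypothesis le0_refl : reflexive T le0.
Hypothesis le0_trans : transitive T le0.
Hypothesis le0_total : forall x y : T, le0 x y \/ le0 y x.
Hypothesis op0_mono : forall x y : T, le0 x y -> le0 (op0 x) (op0 y).

Let equiv (x y : T) : Prop := le0 x y /\ le0 y x.

Let repr (x : T) : T := epsilon (inhabits x) (equiv x).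

Lemma equiv_repr (x : T) : equiv x (repr x).
Proof.
  apply epsilon_spec; exists x; split; apply le0_refl.
Qed.

(** Equivalent points have the same class as a predicate, by extensionality, so [epsilon] makes the
    same choice for both; the inhabitation witnesses agree by proof irrelevance. *)
Lemma repr_eq (x y : T) : equiv x y -> repr x = repr y.
Proof.
  intros [xy yx]; unfold repr.
  replace (equiv y) with (equiv x).
  - f_equal; apply proof_irrelevance.
  - apply functional_extensionality; intros z.
    apply propositional_extensionality.
    unfold equiv; split; intros []; split; eauto.
Qed.

Lemma repr_idem (x : T) : repr (repr x) = repr x.
Proof. symmetry; apply repr_eq, equiv_repr. Qed.

Let quotient : structure :=
  Structure {x : T | repr x = x}
    (fun x y => le0 (proj1_sig x) (proj1_sig y))
    (fun x => exist _ (repr (op0 (proj1_sig x))) (repr_idem _)).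

Let proj (x : T) : quotient := exist _ (repr x) (repr_idem x).

Lemma le_proj (x y : T) : le (proj x) (proj y) <-> le0 x y.
Proof.
  destruct (equiv_repr x), (equiv_repr y); simpl; split; eauto.
Qed.

Lemma quotient_ext (x y : quotient) : proj1_sig x = proj1_sig y -> x = y.
Proof.
  destruct x as [x hx], y as [y hy]; simpl; intros <-.
  f_equal; apply proof_irrelevance.
Qed.

Lemma proj_op (x : T) : proj (op0 x) = op (proj x).
Proof.
  apply quotient_ext; simpl; apply repr_eq.
  destruct (equiv_repr x); split; auto.
Qed.

Lemma quotient_LO_p : LO_p quotient.
Proof.
  split; [split; [split|]|].
  - intros x; apply le0_refl.
  - intros x y z; apply le0_trans.
  - intros x y xy yx; apply quotient_ext.
    rewrite <- (proj2_sig x), <- (proj2_sig y); apply repr_eq; split; auto.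
  - intros x y; apply le0_total.
  - intros x y xy; apply op0_mono in xy.
    destruct (equiv_repr (op0 (proj1_sig x))), (equiv_repr (op0 (proj1_sig y))).
    simpl; eauto.
Qed.

Lemma antisymmetric_quotient :
  exists (D : structure) (p : T -> D),
    LO_p D /\ (forall x, p (op0 x) = op (p x)) /\
    (forall x y, le (p x) (p y) <-> le0 x y).
Proof.
  exists quotient, proj; split; [|split].
  - apply quotient_LO_p.
  - apply proj_op.
  - apply le_proj.
Qed.

End AntisymmetricQuotient.

(** * The preorder on the disjoint union and its quotient *)

Section Amalgam.

Variables (A B C : structure) (i1 : C -> A) (i2 : C -> B).
Hypotheses (LO_A : LO_p A) (LO_B : LO_p B).
Hypotheses (emb1 : embedding i1) (emb2 : embedding i2).

Let reflA : forall x : A, le x x := ord_refl _ _ (proj1 (proj1 LO_A)).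
Let reflB : forall x : B, le x x := ord_refl _ _ (proj1 (proj1 LO_B)).
Let transA : forall x y z : A, le x y -> le y z -> le x z :=
  ord_trans _ _ (proj1 (proj1 LO_A)).
Let transB : forall x y z : B, le x y -> le y z -> le x z :=
  ord_trans _ _ (proj1 (proj1 LO_B)).
Let antiA : forall x y : A, le x y -> le y x -> x = y :=
  ord_antisym _ _ (proj1 (proj1 LO_A)).
Let antiB : forall x y : B, le x y -> le y x -> x = y :=
  ord_antisym _ _ (proj1 (proj1 LO_B)).
Let totA := proj2 (proj1 LO_A).
Let totB := proj2 (proj1 LO_B).
Let monoA : forall x y : A, le x y -> le (op x) (op y) := proj2 LO_A.
Let monoB : forall x y : B, le x y -> le (op x) (op y) := proj2 LO_B.
Let op1 := proj1 (proj2 emb1).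
Let op2 := proj1 (proj2 emb2).
Let le1 := proj2 (proj2 emb1).
Let le2 := proj2 (proj2 emb2).

Definition glued (b : B) (a : A) : Prop := exists c : C, b = i2 c /\ a = i1 c.

(** Given the first two inequalities, the negated conjunction says by antisymmetry that at least one
    of them is strict. *)
Definition forced_lt (b : B) (a : A) : Prop :=
  exists c : C, le b (i2 c) /\ le (i1 c) a /\ ~ (le (i2 c) b /\ le a (i1 c)).

(** The number of [lt_later] steps is the exponent of the iterate, so induction on derivations
    replaces induction on that exponent. *)
Inductive eventually_lt : B -> A -> Prop :=
| lt_now b a : forced_lt b a -> eventually_lt b a
| lt_later b a : eventually_lt (op b) (op a) -> eventually_lt b a.

Lemma forced_lt_mono (b b' : B) (a a' : A) :
  le b' b -> le a a' -> forced_lt b a -> forced_lt b' a'.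
Proof.
  intros hb ha (c & bc & ca & n); exists c; split; [|split]; eauto.
  intros []; apply n; split; eauto.
Qed.

Lemma eventually_lt_mono (b b' : B) (a a' : A) :
  le b' b -> le a a' -> eventually_lt b a -> eventually_lt b' a'.
Proof.
  intros hb ha lt; revert b' a' hb ha.
  induction lt as [b a lt | b a _ IH]; intros b' a' hb ha.
  - apply lt_now; eapply forced_lt_mono; eauto.
  - apply lt_later, IH; auto.
Qed.

Lemma glued_op (b : B) (a : A) : glued b a -> glued (op b) (op a).
Proof.
  intros (c & -> & ->); exists (op c); rewrite op1, op2; auto.
Qed.

(** A witness [d] would satisfy [le c d] through [i2] and [le d c] through [i1]; sending these back
    through the other embedding yields the two excluded inequalities. *)
Lemma glued_not_forced_lt (b : B) (a : A) : glued b a -> ~ forced_lt b a.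
Proof.
  intros (c & -> & ->) (d & h2 & h1 & n); apply n.
  apply le2 in h2; apply le1 in h1; split; [apply le2 | apply le1]; auto.
Qed.

Lemma glued_not_eventually_lt (b : B) (a : A) :
  glued b a -> ~ eventually_lt b a.
Proof.
  intros g lt; induction lt as [b a lt | b a _ IH].
  - exact (glued_not_forced_lt _ _ g lt).
  - exact (IH (glued_op _ _ g)).
Qed.

Definition amalgam_le (x y : A + B) : Prop :=
  match x, y with
  | inl a, inl a' => le a a'
  | inr b, inr b' => le b b'
  | inl a, inr b => ~ eventually_lt b a
  | inr b, inl a => eventually_lt b a \/ glued b a
  end.

Definition amalgam_op (x : A + B) : A + B :=
  match x with inl a => inl (op a) | inr b => inr (op b) end.

(** If [a'] lies strictly above [a], the gluing point itself witnesses the forced inequality. *)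
Lemma glued_le_or_ltA (b : B) (a a' : A) :
  glued b a -> le a' a \/ eventually_lt b a'.
Proof.
  intros (c & -> & ->); destruct (classic (le a' (i1 c))) as [h | h]; auto.
  right; apply lt_now; exists c; destruct (totA a' (i1 c)); try tauto.
  split; [|split]; auto; tauto.
Qed.

Lemma glued_le_or_ltB (b b' : B) (a : A) :
  glued b a -> le b b' \/ eventually_lt b' a.
Proof.
  intros (c & -> & ->); destruct (classic (le (i2 c) b')) as [h | h]; auto.
  right; apply lt_now; exists c; destruct (totB (i2 c) b'); try tauto.
  split; [|split]; auto; tauto.
Qed.

Lemma amalgam_le_refl : reflexive _ amalgam_le.
Proof. intros [a | b]; simpl; auto. Qed.

Lemma amalgam_le_total (x y : A + B) : amalgam_le x y \/ amalgam_le y x.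
Proof.
  destruct x as [a | b], y as [a' | b']; simpl; auto;
    [destruct (classic (eventually_lt b' a)) |
     destruct (classic (eventually_lt b a'))]; auto.
Qed.

Lemma amalgam_le_trans : transitive _ amalgam_le.
Proof.
  intros [a1 | b1] [a2 | b2] [a3 | b3]; simpl; eauto.
  - intros h n lt; apply n; eapply eventually_lt_mono; eauto.
  - intros n [lt | g].
    + destruct (totA a1 a3); auto.
      (* If [le a3 a1], then [b2], being eventually below [a3], is also eventually below [a1]. *)
      destruct n; eapply eventually_lt_mono; eauto.
    + destruct (glued_le_or_ltA _ _ a1 g); tauto.
  - intros n h lt; apply n; eapply eventually_lt_mono; eauto.
  - intros [lt | g] h.
    + left; eapply eventually_lt_mono; eauto.
    + destruct (glued_le_or_ltA _ _ a3 g) as [h' | lt]; auto.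
      (* Here [a3] and [a2] coincide, so the pair is still glued. *)
      rewrite (antiA _ _ h' h); auto.
  - intros [lt | g] n.
    + destruct (totB b1 b3); auto.
      destruct n; eapply eventually_lt_mono; eauto.
    + destruct (glued_le_or_ltB _ b3 _ g); tauto.
  - intros h [lt | g].
    + left; eapply eventually_lt_mono; eauto.
    + destruct (glued_le_or_ltB _ b1 _ g) as [h' | lt]; auto.
      rewrite (antiB _ _ h h'); auto.
Qed.

(** The image of the witness separates the images weakly. Strictness may be lost, since the
    operation need not be injective, but then both images equal that of [op c]. *)
Lemma forced_lt_op (b : B) (a : A) :
  forced_lt b a -> forced_lt (op b) (op a) \/ glued (op b) (op a).
Proof.
  intros (c & bc & ca & _).
  apply monoB in bc; apply monoA in ca; rewrite <- op2 in bc; rewrite <- op1 in ca.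
  destruct (classic (le (i2 (op c)) (op b) /\ le (op a) (i1 (op c)))) as [[] | n].
  - right; exists (op c); auto.
  - left; exists (op c); auto.
Qed.

Lemma amalgam_op_mono (x y : A + B) :
  amalgam_le x y -> amalgam_le (amalgam_op x) (amalgam_op y).
Proof.
  destruct x as [a | b], y as [a' | b']; simpl; auto.
  - intros n lt; apply n, lt_later, lt.
  - intros [lt | g].
    + destruct lt as [b a lt | b a lt]; auto.
      destruct (forced_lt_op _ _ lt); auto using lt_now.
    + right; apply glued_op, g.
Qed.

Lemma amalgam_le_antisym_glued (a : A) (b : B) :
  amalgam_le (inl a) (inr b) -> amalgam_le (inr b) (inl a) -> glued b a.
Proof. simpl; tauto. Qed.

Lemma strong_amalgam :
  exists (D : structure) (j1 : A -> D) (j2 : B -> D),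
    LO_p D /\ embedding j1 /\ embedding j2 /\
    (forall c : C, j1 (i1 c) = j2 (i2 c)) /\
    (forall d : D,
       (exists a : A, j1 a = d) /\ (exists b : B, j2 b = d) <->
       (exists c : C, j1 (i1 c) = d)).
Proof.
  destruct (antisymmetric_quotient (A + B) amalgam_le amalgam_op amalgam_le_refl
              amalgam_le_trans amalgam_le_total amalgam_op_mono)
    as (D & p & LO_D & p_op & p_le).
  assert (p_eq : forall x y, p x = p y <-> amalgam_le x y /\ amalgam_le y x).
  { intros x y; split.
    - intros e; rewrite <- !p_le, e; split; apply LO_D.
    - intros []; apply LO_D; apply p_le; auto. }
  (* The two copies meet exactly in glued pairs: one direction gives commutation over [C], the other
     the strong intersection condition. *)
  assert (p_glued : forall a b, p (inl a) = p (inr b) <-> glued b a).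
  { intros a b; rewrite p_eq; split.
    - intros []; apply amalgam_le_antisym_glued; auto.
    - intros g; split; [apply glued_not_eventually_lt | right]; auto. }
  exists D, (fun a => p (inl a)), (fun b => p (inr b)).
  split; [exact LO_D | split; [|split; [|split]]].
  - split; [|split].
    + intros a a' e; apply p_eq in e as []; auto.
    + intros a; exact (p_op (inl a)).
    + intros a a'; symmetry; exact (p_le (inl a) (inl a')).
  - split; [|split].
    + intros b b' e; apply p_eq in e as []; auto.
    + intros b; exact (p_op (inr b)).
    + intros b b'; symmetry; exact (p_le (inr b) (inr b')).
  - intros c; apply p_glued; exists c; auto.
  - intros d; split.
    + intros [[a <-] [b e]]; symmetry in e; apply p_glued in e as (c & _ & ->).
      exists c; auto.
    + intros [c <-]; split; [exists (i1 c) | exists (i2 c)]; auto.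
      symmetry; apply p_glued; exists c; auto.
Qed.

End Amalgam.

Theorem theorem3p1 : strong_amalgamation_property LO_p.
Proof.
  intros A B C i1 i2 LO_A LO_B _ emb1 emb2.
  apply strong_amalgam; auto.
Qed.
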